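(* Let $k,s\ge 1$ be integers, let $n=2ks$, let $x$ be a variable and $\mathit{i}=\sqrt{-1}$. Let $A_k$ be the $n\times n$ Toeplitz matrix with entries $x$ on the main diagonal, entries $\mathit{i}$ in all positions $(p,p+k)$ and $(p+k,p)$ for $1\le p\le n-k$, and all other entries $0$. Then $$\det(A_k)=\left(F_{\frac{n}{k}+1}(x)\right)^{k},$$ where $F_m(x)$ denotes the $m$-th Fibonacci polynomial.
   Context: The Fibonacci polynomials are defined by $F_0(x)=0$, $F_1(x)=1$, $F_2(x)=x$ and $F_m(x)=xF_{m-1}(x)+F_{m-2}(x)$ for $m\ge 3$. *)

(* Defs.v *)
From HB Require Import structures.
From mathcomp Require Import all_boot all_order all_algebra.
Set Implicit Arguments.
Unset Strict Implicit.
Unset Printing Implicit Defensive.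
Import Order.TTheory GRing.Theory Num.Theory.
Local Open Scope ring_scope.

(* Indexed so that F_0 = 0 and F_1 = 1; the recurrence already gives F_2 = 'X
   (fibpoly2), so F_2 is not a separate initial value. *)
Fixpoint fibpoly (R : nzSemiRingType) (m : nat) : {poly R} :=
  match m with
  | 0 => 0
  | m1.+1 => match m1 with
             | 0 => 1
             | m0.+1 => 'X * fibpoly R m1 + fibpoly R m0
             end
  end.

Lemma fibpoly2 (R : nzSemiRingType) : fibpoly R 2 = 'X.
Proof. by rewrite /= mulr1 addr0. Qed.

(* The entries are polynomials: 'X is the variable x, and 'i%:P is the constant
   polynomial i. Rows and columns are numbered from 0, so the positions
   (p, p + k) and (p + k, p) with 1 <= p <= n - k are those with 0 <= p < n - k;
   this range is automatic for the indices of an n x n matrix. *)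
Definition Amx (C : numClosedFieldType) (n k : nat) : 'M[{poly C}]_n :=
  \matrix_(p < n, q < n)
    if p == q then 'X
    else if (q == p + k :> nat)%N || (p == q + k :> nat)%N then ('i)%:P
    else 0.

(* Main.v *)
Require Import Defs.
From HB Require Import structures.
From mathcomp Require Import all_boot all_order all_algebra.
From mathcomp Require Import perm mxtens.
Import Order.TTheory GRing.Theory Num.Theory.
Local Open Scope ring_scope.

(** Write an index [p < m * k] as [p = a * k + b] with [a < m] and [b < k].
    Moving by [k] changes [a] by one and leaves [b] alone, so the matrix with
    off-diagonals at distance [k] is [T *t 1%:M], where [T] is the [m x m]
    tridiagonal matrix with the same entries; exchanging the roles of [a] and
    [b] permutes rows and columns simultaneously and turns it into the
    block-diagonal matrix [1%:M *t T] with [k] copies of [T]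
    ([Amx_tens], [det_reindex]).  Hence its determinant is [\det T ^+ k]
    ([det_tens1mx]).  Cofactor expansion of [\det T], where the off-diagonal
    entries contribute [- 'i * 'i = 1], gives the recurrence of the Fibonacci
    polynomials ([det_Amx1_rec], [det_Amx1]). *)

Lemma det_castmx (R : comPzRingType) m n (e : m = n) (A : 'M[R]_m) :
  \det (castmx (e, e) A) = \det A.
Proof. by case: n / e. Qed.

Lemma det_reindex (R : comPzRingType) m n (f : 'I_m -> 'I_n) (A : 'M[R]_n) :
  bijective f -> \det (mxsub f f A) = \det A.
Proof.
move=> bij_f.
have e : m = n by have := bij_eq_card bij_f; rewrite !card_ord.
case: n / e f A bij_f => f A /bij_inj inj_f.
have -> : mxsub f f A = row_perm (perm inj_f) (col_perm (perm inj_f) A).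
  by apply/matrixP=> i j; rewrite !mxE !permE.
rewrite row_permE col_permE !det_mulmx !det_perm odd_permV.
by rewrite mulrCA -signr_addb addbb mulr1.
Qed.

Lemma det_tens1mx (R : comPzRingType) k m (N : 'M[R]_m) :
  \det ((1%:M : 'M_k) *t N) = \det N ^+ k.
Proof.
elim: k => [|k IHk]; first by rewrite det_mx00.
rewrite (scalar_mx_block 1 k) tens_block_mx det_castmx !tens0mx det_ublock.
by rewrite tens_scalar1mx det_castmx IHk exprS.
Qed.

(** The bijection sending [a * k + b] to [b * m + a], for [a < m] and [b < k]:
    the reindexing that turns [A *t B] into [B *t A]. *)
Definition swap_tens m k (p : 'I_(m * k)) : 'I_(k * m) :=
  mxtens_index ((mxtens_unindex p).2, (mxtens_unindex p).1).

Lemma swap_tens_bij m k : bijective (@swap_tens m k).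
Proof.
by exists (@swap_tens k m) => p; rewrite /swap_tens mxtens_indexK mxtens_unindexK.
Qed.

Lemma Amx_tens (C : numClosedFieldType) m k :
  Amx C (m * k) k =
  mxsub (@swap_tens m k) (@swap_tens m k) ((1%:M : 'M_k) *t Amx C m 1).
Proof.
apply/matrixP=> p q; rewrite [RHS]mxE /swap_tens tensmxE.
case: (mxtens_indexP p) => a b; case: (mxtens_indexP q) => a' b'.
rewrite !mxtens_indexK !mxE -!val_eqE /= !addn1.
(* [a * k + b + k] becomes [a.+1 * k + b], so that equalities of positions
   split into equalities of quotients and of remainders modulo [k]. *)
rewrite [(a * k + b + k)%N]addnAC [(a' * k + b' + k)%N]addnAC.
rewrite ![(_ * k + k)%N]addnC -!mulSn.
rewrite !eq_addl_mul // !xpair_eqE [(b' == b :> nat)]eq_sym.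
by case: (b == b' :> nat); rewrite ?andbF ?andbT ?mul1r ?mul0r.
Qed.

(** The continuant recurrence: expansion along the first row, and, for the
    second cofactor, along the first column. *)
Lemma det_Amx1_rec (C : numClosedFieldType) m :
  \det (Amx C m.+2 1) = 'X * \det (Amx C m.+1 1) + \det (Amx C m 1).
Proof.
rewrite (expand_det_row _ ord0) !big_ord_recl big1 ?addr0; last first.
  by move=> j _; rewrite !mxE /= mul0r.
rewrite !mxE /=; congr (_ * _ + _).
  rewrite /cofactor expr0 mul1r; congr (\det _).
  by apply/matrixP=> i j; rewrite !mxE -!val_eqE /= !addn1 !eqSS.
rewrite /cofactor (expand_det_col _ ord0) big_ord_recl big1 ?addr0; last first.
  by move=> j _; rewrite !mxE /= mul0r.
rewrite !mxE /= /cofactor expr0 expr1 mul1r mulN1r mulrN mulrA -mulNr -polyCM.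
(* The off-diagonal contribution is [- 'i ^+ 2 = 1]. *)
rewrite -polyCN -expr2 sqrCi opprK mul1r; congr (\det _).
by apply/matrixP=> i j; rewrite !mxE -!val_eqE /= !addn1 !eqSS.
Qed.

Lemma det_Amx1 (C : numClosedFieldType) m :
  \det (Amx C m 1) = fibpoly C m.+1.
Proof.
have [] // : \det (Amx C m 1) = fibpoly C m.+1 /\
             \det (Amx C m.+1 1) = fibpoly C m.+2.
elim: m => [|m [IHm IHm1]].
  by rewrite det_mx00 det_mx11 mxE fibpoly2.
by split; rewrite // det_Amx1_rec IHm1 IHm.
Qed.

Theorem corollary3 (C : numClosedFieldType) (k s n : nat)
    (hk : (1 <= k)%N) (hs : (1 <= s)%N) (hn : n = (2 * k * s)%N) :
  \det (Amx C n k) = fibpoly C (n %/ k + 1) ^+ k.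
Proof.
rewrite {n}hn mulnAC mulnK // addn1 Amx_tens det_reindex; last first.
  exact: swap_tens_bij.
by rewrite det_tens1mx det_Amx1.
Qed.
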